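(* Let $k\ge3$ be an integer. Assume that the exact magnetic field $\mathbf B=(B_1,B_2,B_3)$ is a $C^k$ function of $(x,y)$ satisfying $\nabla\cdot\mathbf B=\partial_xB_1+\partial_yB_2=0$. Assume the reconstructed point values are $k$th-order approximations to the exact point values, i.e. $$(\widehat B_1)_{i\pm\frac12,j}^{\mp,\mu}-B_1(x_{i\pm\frac12},y_j^\mu)=\mathcal O(h^k),\qquad(\widehat B_2)_{i,j\pm\frac12}^{\mu,\mp}-B_2(x_i^\mu,y_{j\pm\frac12})=\mathcal O(h^k),$$ where $h=\max\{\Delta x,\Delta y\}$. Define $$(\widetilde B_1)_{i\pm\frac12,j}^{\mp,\mu}=(\widehat B_1)_{i\pm\frac12,j}^{\mp,\mu}\mp A_1,\qquad(\widetilde B_2)_{i,j\pm\frac12}^{\mu,\mp}=(\widehat B_2)_{i,j\pm\frac12}^{\mu,\mp}\mp A_2,\qquad1\le\mu\le Q,$$ with $$A_1=\frac{\Delta x\,\nabla_h\cdot\widehat{\mathbf B}_{ij}}{2(1+(\Delta x/\Delta y)^2)},\qquad A_2=\frac{\Delta y\,\nabla_h\cdot\widehat{\mathbf B}_{ij}}{2(1+(\Delta y/\Delta x)^2)},$$ $$\nabla_h\cdot\widehat{\mathbf B}_{ij}=\sum_{\mu=1}^Q\omega_\mu\left(\frac{(\widehat B_1)_{i+\frac12,j}^{-,\mu}-(\widehat B_1)_{i-\frac12,j}^{+,\mu}}{\Delta x}+\frac{(\widehat B_2)_{i,j+\frac12}^{\mu,-}-(\widehat B_2)_{i,j-\frac12}^{\mu,+}}{\Delta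 y}\right).$$ Then the modified point values are also $k$th-order approximations to the exact point values: $$(\widetilde B_1)_{i\pm\frac12,j}^{\mp,\mu}-B_1(x_{i\pm\frac12},y_j^\mu)=\mathcal O(h^k),\qquad(\widetilde B_2)_{i,j\pm\frac12}^{\mu,\mp}-B_2(x_i^\mu,y_{j\pm\frac12})=\mathcal O(h^k).$$
   Context: The 2D (bounded) computational domain is partitioned into uniform rectangular cells $I_{ij}=(x_{i-\frac12},x_{i+\frac12})\times(y_{j-\frac12},y_{j+\frac12})$ with step sizes $\Delta x,\Delta y>0$; $C^k$ is understood up to the boundary, and $\mathcal O(h^k)$ means bounded in absolute value by a constant times $h^k$ as the mesh is refined, the constant being independent of $\Delta x,\Delta y,i,j,\mu$. On each cell edge a $Q$-point quadrature rule is used with nodes $x_i^\mu\in[x_{i-\frac12},x_{i+\frac12}]$, $y_j^\mu\in[y_{j-\frac12},y_{j+\frac12}]$ and weights $\omega_\mu$ with $\sum_{\mu=1}^Q\omega_\mu=1$; the rule is accurate enough for order $k$, i.e. the difference between $\sum_\mu\omega_\mu f(y_j^\mu)$ and $\frac1{\Delta y}\int_{y_{j-1/2}}^{y_{j+1/2}}f\,dy$ is $\mathcal O(h^k)$ for $C^k$ functions $f$, and likewise in $x$ (for example the $Q$-point Gauss rule with $Q=\lceil k/2\rceil$, or the $Q$-point Gauss--Lobatto rule with $Q=\lceil(k+2)/2\rceil$). $(\widehat B_1)_{i\pm\frac12,j}^{\mp,\mu}$ is the reconstructed value, from inside $I_{ij}$, of $B_1$ at $(x_{i\pm\frac12},y_j^\mu)$;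 $(\widehat B_2)_{i,j\pm\frac12}^{\mu,\mp}$ that of $B_2$ at $(x_i^\mu,y_{j\pm\frac12})$. Upper signs go together and lower signs go together. *)

(* Defs.v *)
From Stdlib Require Import Reals ZArith Lia Lra.
From Coquelicot Require Import Coquelicot.
Open Scope R_scope.

Definition adherent (A : R * R -> Prop) (p : R * R) : Prop :=
  forall P : R * R -> Prop, locally p P -> exists q, A q /\ P q.

Definition bounded_set (A : R * R -> Prop) : Prop :=
  exists r : R, forall p, A p -> Rabs (fst p) <= r /\ Rabs (snd p) <= r.

Definition continuous_within (A : R * R -> Prop) (g : R -> R -> R)
    (p : R * R) : Prop :=
  filterlim (fun q : R * R => g (fst q) (snd q))
    (within A (locally p)) (locally (g (fst p) (snd p))).

(** [Omega] is meant to be open.  [f] is C^k up to the boundary: all partial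
    derivatives of order at most [k] exist in [Omega] and extend continuously
    to its closure; [D p q] is the continuous extension of
    d^(p+q) f / dx^p dy^q. *)
Definition Ck_closure (k : nat) (Omega : R * R -> Prop) (f : R -> R -> R)
    : Prop :=
  exists D : nat -> nat -> R -> R -> R,
    (forall x y, adherent Omega (x, y) -> D 0%nat 0%nat x y = f x y) /\
    (forall p q z, (p + q <= k)%nat -> adherent Omega z ->
       continuous_within (adherent Omega) (D p q) z) /\
    (forall p q x y, (p + q < k)%nat -> Omega (x, y) ->
       is_derive (fun t => D p q t y) x (D (S p) q x y) /\
       is_derive (fun t => D p q x t) y (D p (S q) x y)).

Definition Ck_line (k : nat) (f : R -> R) : Prop :=
  forall n x, (n <= k)%nat ->
    ex_derive_n f n x /\ continuous (Derive_n f n) x.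

(** A uniform mesh: cell (i, j) is centred at
    (mesh_x0 + i mesh_dx, mesh_y0 + j mesh_dy), and [mesh_cell] selects the
    cells that are used. *)
Record mesh : Type := Mesh {
  mesh_x0 : R;
  mesh_y0 : R;
  mesh_dx : R;
  mesh_dy : R;
  mesh_cell : Z -> Z -> Prop;
  mesh_dx_pos : 0 < mesh_dx;
  mesh_dy_pos : 0 < mesh_dy
}.

(** [upper] and [lower] choose one of the signs in "+-" / "-+" throughout. *)
Inductive side : Type := upper | lower.

Definition sgn (s : side) : R :=
  match s with upper => 1 | lower => -1 end.

(** x_{i +- 1/2} and y_{j +- 1/2} *)
Definition xhalf (m : mesh) (s : side) (i : Z) : R :=
  mesh_x0 m + (IZR i + sgn s / 2) * mesh_dx m.

Definition yhalf (m : mesh) (s : side) (j : Z) : R :=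
  mesh_y0 m + (IZR j + sgn s / 2) * mesh_dy m.

Definition mesh_h (m : mesh) : R := Rmax (mesh_dx m) (mesh_dy m).

Definition open_cell (m : mesh) (i j : Z) (p : R * R) : Prop :=
  xhalf m lower i < fst p < xhalf m upper i /\
  yhalf m lower j < snd p < yhalf m upper j.

Definition closed_cell (m : mesh) (i j : Z) (p : R * R) : Prop :=
  xhalf m lower i <= fst p <= xhalf m upper i /\
  yhalf m lower j <= snd p <= yhalf m upper j.

(** Distinct open cells of a mesh are disjoint by construction, and cell edges
    are disregarded, as usual. *)
Definition partitions (m : mesh) (Omega : R * R -> Prop) : Prop :=
  (forall i j p, mesh_cell m i j -> open_cell m i j p -> Omega p) /\
  (forall p, Omega p -> exists i j, mesh_cell m i j /\ closed_cell m i j p).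

(** e = O(h^k) along a family of meshes as h -> 0, uniformly in the cell
    (i, j), in 1 <= mu <= Q, and in the mesh sizes. *)
Definition bigO_h {T : Type} (M : T -> mesh) (Q k : nat)
    (e : T -> Z -> Z -> nat -> R) : Prop :=
  exists C h0 : R, 0 < h0 /\
    forall t i j mu, mesh_h (M t) <= h0 -> mesh_cell (M t) i j ->
      (1 <= mu <= Q)%nat ->
      Rabs (e t i j mu) <= C * mesh_h (M t) ^ k.

Definition quad_error (Q : nat) (w : nat -> R) (f : R -> R) (z : nat -> R)
    (a b : R) : R :=
  sum_n_m (fun mu => w mu * f (z mu)) 1 Q - / (b - a) * RInt f a b.

(** Point values on the edges of one mesh, seen from inside the cells: for the
    first component, [v upper i j mu] is v_{i+1/2,j}^{-,mu} and
    [v lower i j mu] is v_{i-1/2,j}^{+,mu}; for the second component they are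
    v_{i,j+1/2}^{mu,-} and v_{i,j-1/2}^{mu,+}. *)
Definition edge_values : Type := side -> Z -> Z -> nat -> R.

Definition div_h (m : mesh) (Q : nat) (w : nat -> R) (V1 V2 : edge_values)
    (i j : Z) : R :=
  sum_n_m (fun mu => w mu *
    ((V1 upper i j mu - V1 lower i j mu) / mesh_dx m +
     (V2 upper i j mu - V2 lower i j mu) / mesh_dy m)) 1 Q.

Definition corr1 (m : mesh) (Q : nat) (w : nat -> R) (V1 V2 : edge_values)
    (i j : Z) : R :=
  mesh_dx m * div_h m Q w V1 V2 i j /
  (2 * (1 + (mesh_dx m / mesh_dy m) ^ 2)).

Definition corr2 (m : mesh) (Q : nat) (w : nat -> R) (V1 V2 : edge_values)
    (i j : Z) : R :=
  mesh_dy m * div_h m Q w V1 V2 i j /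
  (2 * (1 + (mesh_dy m / mesh_dx m) ^ 2)).

Definition modified1 (m : mesh) (Q : nat) (w : nat -> R) (V1 V2 : edge_values)
    : edge_values :=
  fun s i j mu => V1 s i j mu - sgn s * corr1 m Q w V1 V2 i j.

Definition modified2 (m : mesh) (Q : nat) (w : nat -> R) (V1 V2 : edge_values)
    : edge_values :=
  fun s i j mu => V2 s i j mu - sgn s * corr2 m Q w V1 V2 i j.

(* Main.v *)
Require Import Defs.
From Stdlib Require Import Reals ZArith Lia Lra Classical ClassicalEpsilon.
From Coquelicot Require Import Coquelicot.
Open Scope R_scope.

(** The corrections [corr1] and [corr2] are O(h^k), so subtracting them from
    kth-order values keeps the order.

    Let the outflow of a cell be dx dy times its discrete divergence.  Since
    corr1 = outflow * dy / (2 (dx^2 + dy^2)), and symmetrically for corr2, and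
    since h dy <= dx^2 + dy^2, it suffices that the outflow is O(h^(k+1))
    ([corrections_le]).  A change of the edge values by O(h^k) changes the
    outflow by O(h^(k+1)) ([outflow_perturb]), so the reconstructed values may
    be replaced by those of any kth-order approximation of B on the cell.

    The approximation used is the Taylor polynomial of total degree below k at
    the centre of the cell ([taylor_closed_cell]).  Its coefficients inherit
    the relation d_x B1 + d_y B2 = 0 ([div_free_derivatives]), so it is itself
    divergence free, and its outflow computed with exact edge averages is zero
    by a coefficientwise cancellation ([tpoly_flux_zero]).  What remains is the
    quadrature error of finitely many monomials centred in the cell, with
    coefficients bounded uniformly in the cell ([derivatives_bounded]).

    Passing to polynomials is essential for uniformity: the quadrature rule is
    accurate with a constant depending on the integrand, whereas the
    restrictions of B to the edges form a family that varies with the mesh and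
    the cell.  The centred monomials vary with the cell too, but they are
    combinations of the fixed monomials y^n whose coefficients are bounded
    because the domain is bounded ([quad_error_centred_monomial_bigO]). *)

(** * Finite sums *)

(** Peeling off the first term, rather than the last, makes shifts of the
    summation index in Taylor sums definitional. *)
Fixpoint psum (n : nat) (f : nat -> R) : R :=
  match n with
  | O => 0
  | S n => f O + psum n (fun i => f (S i))
  end.

Lemma psum_recr n f : psum (S n) f = psum n f + f n.
Proof.
  revert f; induction n as [|n IH]; intros f.
  - simpl; ring.
  - change (psum (S (S n)) f) with (f O + psum (S n) (fun i => f (S i))).
    rewrite IH; simpl; ring.
Qed.

Lemma psum_ext n f g :
  (forall i, (i < n)%nat -> f i = g i) -> psum n f = psum n g.
Proof.
  revert f g; induction n as [|n IH]; intros f g H; [reflexivity|].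
  simpl; rewrite (H O) by lia; f_equal; apply IH; intros; apply H; lia.
Qed.

Lemma psum_plus n f g : psum n (fun i => f i + g i) = psum n f + psum n g.
Proof. induction n as [|n IH]; [simpl; ring | rewrite !psum_recr, IH; ring]. Qed.

Lemma psum_scal c n f : psum n (fun i => c * f i) = c * psum n f.
Proof. induction n as [|n IH]; [simpl; ring | rewrite !psum_recr, IH; ring]. Qed.

Lemma psum_minus n f g : psum n (fun i => f i - g i) = psum n f - psum n g.
Proof. induction n as [|n IH]; [simpl; ring | rewrite !psum_recr, IH; ring]. Qed.

Lemma psum_zero n f : (forall i, (i < n)%nat -> f i = 0) -> psum n f = 0.
Proof.
  intros H; rewrite (psum_ext _ _ (fun i => 0 * f i)).
  - rewrite psum_scal; ring.
  - intros i Hi; rewrite H by assumption; ring.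
Qed.

Lemma psum_swap m n (f : nat -> nat -> R) :
  psum m (fun i => psum n (f i)) = psum n (fun j => psum m (fun i => f i j)).
Proof.
  induction m as [|m IH].
  - rewrite (psum_zero n); [reflexivity | intros; reflexivity].
  - rewrite psum_recr, IH, <- psum_plus.
    apply psum_ext; intros j _; rewrite psum_recr; reflexivity.
Qed.

Lemma psum_abs_le n f g :
  (forall i, (i < n)%nat -> Rabs (f i) <= g i) -> Rabs (psum n f) <= psum n g.
Proof.
  induction n as [|n IH]; intros H.
  - simpl; rewrite Rabs_R0; lra.
  - rewrite !psum_recr.
    eapply Rle_trans; [apply Rabs_triang|].
    apply Rplus_le_compat; [apply IH; intros; apply H | apply H]; lia.
Qed.

Lemma psum_const n c : psum n (fun _ => c) = INR n * c.
Proof.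
  induction n as [|n IH]; [simpl; ring | rewrite psum_recr, IH, S_INR; ring].
Qed.

Lemma psum_abs_le_const n f c :
  (forall i, (i < n)%nat -> Rabs (f i) <= c) -> Rabs (psum n f) <= INR n * c.
Proof. intros H; rewrite <- psum_const; apply psum_abs_le, H. Qed.

Lemma psum_ge_term n f i :
  (forall j, 0 <= f j) -> (i < n)%nat -> f i <= psum n f.
Proof.
  intros H; revert i; induction n as [|n IH]; intros i Hi; [lia|].
  rewrite psum_recr; destruct (Nat.eq_dec i n) as [->|Hne].
  - assert (Hp := psum_abs_le n (fun _ => 0) f).
    rewrite psum_const, Rmult_0_r, Rabs_R0 in Hp.
    specialize (Hp (fun i _ => H i)); lra.
  - specialize (IH i ltac:(lia)); specialize (H n); lra.
Qed.

Lemma sum_n_m_psum Q f : sum_n_m f 1 Q = psum Q (fun i => f (S i)).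
Proof.
  induction Q as [|Q IH].
  - apply (@sum_n_m_zero R_AbelianMonoid); lia.
  - rewrite psum_recr, <- IH.
    apply (@sum_n_Sm R_AbelianMonoid); lia.
Qed.

Lemma is_derive_psum n (f : nat -> R -> R) (l : nat -> R) x :
  (forall i, (i < n)%nat -> is_derive (f i) x (l i)) ->
  is_derive (fun t => psum n (fun i => f i t)) x (psum n l).
Proof.
  revert f l; induction n as [|n IH]; intros f l H.
  - apply (@is_derive_const R_AbsRing R_NormedModule 0).
  - apply (@is_derive_plus R_AbsRing R_NormedModule); [apply H; lia|].
    apply (IH (fun i => f (S i)) (fun i => l (S i))); intros; apply H; lia.
Qed.

Lemma continuous_psum {U : UniformSpace} n (f : nat -> U -> R) z :
  (forall i, (i < n)%nat -> continuous (f i) z) ->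
  continuous (fun t => psum n (fun i => f i t)) z.
Proof.
  revert f; induction n as [|n IH]; intros f H.
  - apply continuous_const.
  - apply (@continuous_plus U R_AbsRing R_NormedModule); [apply H; lia|].
    apply (IH (fun i => f (S i))); intros; apply H; lia.
Qed.

(** * Taylor polynomials *)

(** The sequence [g] stands for a function and its successive derivatives.
    The difference between [g 0] and its Taylor sum vanishes at [c], and its
    derivative is the same difference for the shifted sequence; the mean value
    theorem thus gains one power of |y - c| per order.  The factor 1/n! of the
    sharp estimate is given up in exchange. *)
Lemma taylor_remainder n (g : nat -> R -> R) lo hi K :
  (forall i t, (i < n)%nat -> lo < t < hi -> is_derive (g i) t (g (S i) t)) ->
  (forall t, lo < t < hi -> Rabs (g n t) <= K) ->
  forall c y, lo < c < hi -> lo < y < hi ->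
  Rabs (g O y - psum n (fun i => g i c / INR (fact i) * (y - c) ^ i))
    <= K * Rabs (y - c) ^ n.
Proof.
  revert g; induction n as [|n IH]; intros g Hd HK c y Hc Hy.
  - simpl; rewrite Rminus_0_r, Rmult_1_r; apply HK, Hy.
  - set (F := fun t => g O t -
      psum (S n) (fun i => g i c / INR (fact i) * (t - c) ^ i)).
    set (dF := fun t => g 1%nat t -
      psum n (fun i => g (S i) c / INR (fact i) * (t - c) ^ i)).
    assert (HF : forall t, lo < t < hi -> is_derive F t (dF t)).
    { intros t Ht; unfold F, dF.
      apply (@is_derive_minus R_AbsRing R_NormedModule); [apply Hd; [lia|lra]|].
      replace (psum n _) with (psum (S n) (fun i =>
        g i c / INR (fact i) * (INR i * (t - c) ^ pred i))).
      - apply (is_derive_psum (S n)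
          (fun i t => g i c / INR (fact i) * (t - c) ^ i)).
        intros i _.
        apply is_derive_scal.
        replace (INR i * (t - c) ^ pred i)
          with (INR i * 1 * (t - c) ^ pred i) by ring.
        apply (is_derive_pow (fun t => t - c)).
        auto_derive; [trivial | ring].
      - cbn [psum]; simpl INR at 2; rewrite Rmult_0_l, Rmult_0_r, Rplus_0_l.
        apply psum_ext; intros i _.
        rewrite fact_simpl, mult_INR; simpl pred.
        field; split; [apply INR_fact_neq_0 | apply not_0_INR; lia]. }
    assert (Hin : forall t, Rmin c y <= t <= Rmax c y -> lo < t < hi).
    { intros t; unfold Rmin, Rmax; destruct (Rle_dec c y); lra. }
    destruct (MVT_gen F c y dF) as [xi [Hxi Heq]].
    + intros t Ht; apply HF, Hin; lra.
    + intros t Ht; apply continuity_pt_filterlim.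
      apply (@ex_derive_continuous R_AbsRing R_NormedModule).
      eexists; apply HF, Hin, Ht.
    + assert (HFc : F c = 0).
      { unfold F; cbn [psum]; simpl fact; simpl INR; simpl pow.
        rewrite (psum_zero n); [field|].
        intros i _; rewrite Rminus_diag; simpl; ring. }
      rewrite HFc, Rminus_0_r in Heq.
      change (Rabs (F y) <= K * Rabs (y - c) ^ S n).
      rewrite Heq, Rabs_mult; simpl pow.
      rewrite (Rmult_comm (Rabs (y - c))), <- Rmult_assoc.
      apply Rmult_le_compat_r; [apply Rabs_pos|].
      assert (HKp : 0 <= K).
      { eapply Rle_trans; [apply Rabs_pos | apply (HK c Hc)]. }
      eapply Rle_trans.
      * apply (IH (fun i => g (S i))); auto.
        intros i t Hi Ht; apply Hd; [lia|lra].
      * apply Rmult_le_compat_l; [exact HKp|].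
        apply pow_incr; split; [apply Rabs_pos|].
        revert Hxi; unfold Rmin, Rmax.
        destruct (Rle_dec c y); intros ?; split_Rabs; lra.
Qed.

Definition tpoly (k : nat) (a : nat -> nat -> R) (X Y : R) : R :=
  psum k (fun p => psum (k - p) (fun q =>
    a p q / (INR (fact p) * INR (fact q)) * X ^ p * Y ^ q)).

Lemma adherent_incl (A : R * R -> Prop) z : A z -> adherent A z.
Proof. intros Hz P HP; exists z; split; [exact Hz | apply locally_singleton, HP]. Qed.

Lemma open_slices (A : R * R -> Prop) x y : open A -> A (x, y) ->
  locally x (fun t => A (t, y)) /\ locally y (fun t => A (x, t)).
Proof.
  intros HA Hz; destruct (HA _ Hz) as [e He]; split; exists e; intros t Ht;
    apply He; split; simpl; auto; apply ball_center.
Qed.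

(** Expand in x along the horizontal segment through (x, y), then expand the
    coefficient of order [p] in y up to order [k - p]: its error h^(k-p) is
    multiplied by h^p. *)
Lemma taylor2_remainder k (D : nat -> nat -> R -> R -> R) x0 x1 y0 y1 K h :
  (forall p q x y, (p + q < k)%nat -> x0 < x < x1 -> y0 < y < y1 ->
     is_derive (fun t => D p q t y) x (D (S p) q x y) /\
     is_derive (fun t => D p q x t) y (D p (S q) x y)) ->
  (forall p q x y, (p + q <= k)%nat -> x0 < x < x1 -> y0 < y < y1 ->
     Rabs (D p q x y) <= K) ->
  x1 - x0 <= h -> y1 - y0 <= h ->
  forall cx cy x y,
    x0 < cx < x1 -> y0 < cy < y1 -> x0 < x < x1 -> y0 < y < y1 ->
  Rabs (D O O x y - tpoly k (fun p q => D p q cx cy) (x - cx) (y - cy))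
    <= (1 + INR k) * K * h ^ k.
Proof.
  intros Hd HK Hhx Hhy cx cy x y Hcx Hcy Hx Hy.
  assert (HK0 : 0 <= K).
  { eapply Rle_trans; [apply Rabs_pos | apply (HK O O cx cy); auto; lia]. }
  assert (Hh : 0 <= h) by lra.
  assert (Hax : Rabs (x - cx) <= h) by (split_Rabs; lra).
  assert (Hay : Rabs (y - cy) <= h) by (split_Rabs; lra).
  assert (H1 : Rabs (D O O x y -
    psum k (fun p => D p O cx y / INR (fact p) * (x - cx) ^ p)) <= K * h ^ k).
  { eapply Rle_trans.
    - apply (taylor_remainder k (fun p t => D p O t y) x0 x1 K); auto.
      + intros i t Hi Ht; apply Hd; auto; lia.
      + intros t Ht; apply HK; auto; lia.
    - apply Rmult_le_compat_l; [exact HK0|].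
      apply pow_incr; split; [apply Rabs_pos | exact Hax]. }
  assert (H2 : Rabs (
    psum k (fun p => D p O cx y / INR (fact p) * (x - cx) ^ p) -
    tpoly k (fun p q => D p q cx cy) (x - cx) (y - cy)) <= INR k * (K * h ^ k)).
  { unfold tpoly; rewrite <- psum_minus.
    apply psum_abs_le_const; intros p Hp.
    rewrite (psum_ext _ _ (fun q => / INR (fact p) * (x - cx) ^ p *
      (D p q cx cy / INR (fact q) * (y - cy) ^ q))).
    2:{ intros q _; field; split; apply INR_fact_neq_0. }
    rewrite psum_scal.
    match goal with |- Rabs (?a / ?b * ?c - ?d * ?e) <= _ =>
      replace (a / b * c - d * e) with (/ b * c * (a - e))
        by (unfold Rdiv; ring) end.
    rewrite !Rabs_mult, <- RPow_abs.
    assert (Hf : Rabs (/ INR (fact p)) <= 1).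
    { assert (1 <= INR (fact p)).
      { change 1 with (INR 1); apply le_INR; generalize (lt_O_fact p); lia. }
      rewrite Rabs_pos_eq.
      - rewrite <- Rinv_1; apply Rinv_le_contravar; lra.
      - apply Rlt_le, Rinv_0_lt_compat; lra. }
    assert (HT : Rabs (D p O cx y -
      psum (k - p) (fun q => D p q cx cy / INR (fact q) * (y - cy) ^ q))
      <= K * h ^ (k - p)).
    { eapply Rle_trans.
      - apply (taylor_remainder (k - p) (fun q t => D p q cx t) y0 y1 K); auto.
        + intros i t Hi Ht; apply Hd; auto; lia.
        + intros t Ht; apply HK; auto; lia.
      - apply Rmult_le_compat_l; [exact HK0|].
        apply pow_incr; split; [apply Rabs_pos | exact Hay]. }
    replace (K * h ^ k) with (1 * h ^ p * (K * h ^ (k - p))).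
    2:{ replace k with (p + (k - p))%nat at 2 by lia; rewrite pow_add; ring. }
    apply Rmult_le_compat; [| apply Rabs_pos | | exact HT].
    - apply Rmult_le_pos; [apply Rabs_pos | apply pow_le, Rabs_pos].
    - apply Rmult_le_compat; [apply Rabs_pos | apply pow_le, Rabs_pos | exact Hf |].
      apply pow_incr; split; [apply Rabs_pos | exact Hax]. }
  match type of H1 with Rabs (?a - ?b) <= _ =>
  match type of H2 with Rabs (_ - ?c) <= _ =>
    replace (a - c) with ((a - b) + (b - c)) by ring end end.
  eapply Rle_trans; [apply Rabs_triang|].
  lra.
Qed.

(** Edges of a cell may lie on the boundary of the domain, where the derivatives
    are only continuous extensions: Taylor estimates hold inside the cell and
    reach its edges through this lemma. *)
Lemma continuous_within_bound (A S : R * R -> Prop) (g P : R -> R -> R) z C :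
  continuous_within A g z ->
  continuous (fun q : R * R => P (fst q) (snd q)) z ->
  (forall q, S q -> A q) -> adherent S z ->
  (forall q, S q -> Rabs (g (fst q) (snd q) - P (fst q) (snd q)) <= C) ->
  Rabs (g (fst z) (snd z) - P (fst z) (snd z)) <= C.
Proof.
  intros Hg HP HSA Hz Hb.
  apply Rnot_lt_le; intros Hlt.
  set (v := Rabs _) in Hlt.
  assert (He : 0 < (v - C) / 2) by lra.
  pose (e := mkposreal _ He).
  specialize (Hg _ (locally_ball _ e)).
  specialize (HP _ (locally_ball _ e)).
  unfold filtermap, within in Hg, HP.
  destruct (Hz _ (filter_and _ _ Hg HP)) as [q [HSq [H1 H2]]].
  specialize (H1 (HSA _ HSq)); specialize (Hb _ HSq).
  apply Rabs_lt_between in H1; apply Rabs_lt_between in H2.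
  unfold minus, plus, opp in H1, H2; simpl in H1, H2.
  revert Hb; unfold v in *; split_Rabs; lra.
Qed.

Lemma closed_cell_adherent m i j z :
  closed_cell m i j z -> adherent (open_cell m i j) z.
Proof.
  destruct z as [x y]; intros [Hx Hy] P [e He]; simpl in Hx, Hy.
  assert (Hdx := mesh_dx_pos m); assert (Hdy := mesh_dy_pos m).
  assert (Hx' : xhalf m lower i < xhalf m upper i).
  { unfold xhalf; simpl; lra. }
  assert (Hy' : yhalf m lower j < yhalf m upper j).
  { unfold yhalf; simpl; lra. }
  (* Moving a little towards the centre enters the open cell. *)
  assert (Hmove : forall a b t, a < b -> a <= t <= b ->
    exists s, a < s < b /\ Rabs (s - t) < e).
  { intros a b t Hab Ht; destruct e as [e e0]; simpl.
    pose (d := Rmin (e / 2) ((b - a) / 4)).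
    assert (0 < d <= e / 2 /\ d <= (b - a) / 4).
    { unfold d; repeat split; [apply Rmin_pos; lra | apply Rmin_l | apply Rmin_r]. }
    destruct (Rle_dec t ((a + b) / 2)).
    - exists (t + d); split; [lra | split_Rabs; lra].
    - exists (t - d); split; [lra | split_Rabs; lra]. }
  destruct (Hmove _ _ x Hx' Hx) as [s [Hs Hsx]].
  destruct (Hmove _ _ y Hy' Hy) as [r [Hr Hry]].
  exists (s, r); split; [split; assumption|].
  apply He; split; assumption.
Qed.

Lemma adherent_mono (A B : R * R -> Prop) z :
  (forall q, A q -> B q) -> adherent A z -> adherent B z.
Proof. intros H Hz P HP; destruct (Hz P HP) as [q [Hq HPq]]; eauto. Qed.

Lemma continuous_tpoly k a cx cy z :
  continuous (fun q : R * R => tpoly k a (fst q - cx) (snd q - cy)) z.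
Proof.
  assert (Hpow : forall (f : R * R -> R) n, continuous f z ->
    continuous (fun q => f q ^ n) z).
  { intros f n Hf; induction n as [|n IH]; simpl.
    - apply continuous_const.
    - apply (@continuous_mult (prod_UniformSpace R_UniformSpace R_UniformSpace) R_AbsRing);
        assumption. }
  unfold tpoly.
  apply (continuous_psum (U := prod_UniformSpace R_UniformSpace R_UniformSpace)
    k (fun p q => psum (k - p) (fun r => a p r / (INR (fact p) * INR (fact r)) *
      (fst q - cx) ^ p * (snd q - cy) ^ r))); intros p _.
  apply (continuous_psum (U := prod_UniformSpace R_UniformSpace R_UniformSpace)
    (k - p) (fun r q => a p r / (INR (fact p) * INR (fact r)) *
      (fst q - cx) ^ p * (snd q - cy) ^ r)); intros r _.
  apply (@continuous_mult (prod_UniformSpace R_UniformSpace R_UniformSpace) R_AbsRing).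
  - apply (@continuous_mult (prod_UniformSpace R_UniformSpace R_UniformSpace) R_AbsRing).
    + apply continuous_const.
    + apply Hpow.
      apply (@continuous_minus (prod_UniformSpace R_UniformSpace R_UniformSpace) R_AbsRing R_NormedModule).
      * apply continuous_fst.
      * apply continuous_const.
  - apply Hpow.
    apply (@continuous_minus (prod_UniformSpace R_UniformSpace R_UniformSpace) R_AbsRing R_NormedModule).
    + apply continuous_snd.
    + apply continuous_const.
Qed.

(** * Derivatives of the field *)

(** Heine-Borel with the gauge doubling as the bound: [delta u v] is chosen so
    small that |g| <= 1 / [delta u v] near (u, v), hence a positive lower bound
    of the gauge bounds g.  Away from the closure of [A] the gauge only has to
    isolate (u, v) from [A]. *)
Lemma continuous_closure_bounded (A : R * R -> Prop) (g : R -> R -> R) :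
  bounded_set A ->
  (forall z, adherent A z -> continuous_within (adherent A) g z) ->
  exists K, forall x y, A (x, y) -> Rabs (g x y) <= K.
Proof.
  intros [r Hr] Hg.
  assert (Hloc : forall u v, exists d : posreal, forall x y, A (x, y) ->
    Rabs (x - u) < d -> Rabs (y - v) < d -> Rabs (g x y) <= / d).
  { intros u v.
    destruct (excluded_middle_informative (adherent A (u, v))) as [Ha|Hna].
    - destruct (Hg _ Ha _ (locally_ball _ (mkposreal 1 Rlt_0_1))) as [e He].
      assert (Hv : 0 < Rabs (g u v) + 1) by (generalize (Rabs_pos (g u v)); lra).
      assert (Hd : 0 < Rmin e (/ (Rabs (g u v) + 1))).
      { apply Rmin_pos; [apply cond_pos | apply Rinv_0_lt_compat, Hv]. }
      exists (mkposreal _ Hd); simpl; intros x y Hxy Hx Hy.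
      assert (Hb : ball (g u v) 1 (g x y)).
      { apply (He (x, y)).
        - split; eapply Rlt_le_trans; [exact Hx | apply Rmin_l | exact Hy | apply Rmin_l].
        - apply adherent_incl, Hxy. }
      apply Rle_trans with (Rabs (g u v) + 1).
      + apply Rabs_lt_between in Hb.
        unfold minus, plus, opp in Hb; simpl in Hb; split_Rabs; lra.
      + rewrite <- (Rinv_inv (Rabs (g u v) + 1)) at 1.
        apply Rinv_le_contravar; [exact Hd | apply Rmin_r].
    - apply not_all_ex_not in Hna; destruct Hna as [P HP].
      apply imply_to_and in HP; destruct HP as [[e He] HnP].
      exists e; intros x y Hxy Hx Hy; exfalso; apply HnP.
      exists (x, y); split; [exact Hxy | apply He; split; assumption]. }
  pose (delta := fun u v => proj1_sig (constructive_indefinite_description _ (Hloc u v))).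
  destruct (compactness_value_2d (- r) r (- r) r delta) as [d Hd].
  exists (/ d); intros x y Hxy.
  destruct (Hr _ Hxy) as [Hx Hy]; simpl in Hx, Hy.
  apply Rabs_le_between in Hx; apply Rabs_le_between in Hy.
  apply Rnot_lt_le; intros Hlt; apply (Hd x y Hx Hy).
  intros (u & v & _ & _ & Hu & Hv & Hle).
  revert Hlt; apply Rle_not_lt.
  apply Rle_trans with (/ delta u v).
  - exact (proj2_sig (constructive_indefinite_description _ (Hloc u v)) x y Hxy Hu Hv).
  - apply Rinv_le_contravar; [apply cond_pos | exact Hle].
Qed.

Lemma common_bound n (P : nat -> R -> Prop) :
  (forall i K K', K <= K' -> P i K -> P i K') ->
  (forall i, (i < n)%nat -> exists K, P i K) ->
  exists K, forall i, (i < n)%nat -> P i K.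
Proof.
  intros Hmon; induction n as [|n IH]; intros H.
  - exists 0; intros; lia.
  - destruct IH as [K HK]; [intros; apply H; lia|].
    destruct (H n ltac:(lia)) as [K' HK'].
    exists (Rmax K K'); intros i Hi; destruct (Nat.eq_dec i n) as [->|Hne].
    + eapply Hmon; [apply Rmax_r | exact HK'].
    + eapply Hmon; [apply Rmax_l | apply HK; lia].
Qed.

Lemma derivatives_bounded k (A : R * R -> Prop) (D : nat -> nat -> R -> R -> R) :
  bounded_set A ->
  (forall p q z, (p + q <= k)%nat -> adherent A z ->
     continuous_within (adherent A) (D p q) z) ->
  exists K, forall p q x y, (p + q <= k)%nat -> A (x, y) -> Rabs (D p q x y) <= K.
Proof.
  intros HA Hc.
  destruct (common_bound (S k) (fun p K => forall q x y, (p + q <= k)%nat ->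
    A (x, y) -> Rabs (D p q x y) <= K)) as [K HK].
  - intros p K K' HKK H q x y Hpq Hz; eapply Rle_trans; [apply H|]; eauto.
  - intros p Hp.
    destruct (common_bound (S k - p) (fun q K => forall x y,
      A (x, y) -> Rabs (D p q x y) <= K)) as [K HK].
    + intros q K K' HKK H x y Hz; eapply Rle_trans; [apply H|]; eauto.
    + intros q Hq; apply continuous_closure_bounded; [exact HA|].
      intros z Hz; apply Hc; [lia | exact Hz].
    + exists K; intros q x y Hpq; apply HK; lia.
  - exists K; intros p q x y Hpq; apply HK; [lia | exact Hpq].
Qed.

(** A derivative of the zero function is zero: differentiate the divergence
    first [q] times in y, then [p] times in x. *)
Lemma div_free_derivatives k (A : R * R -> Prop) (B1 B2 : R -> R -> R)
    (D1 D2 : nat -> nat -> R -> R -> R) :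
  open A ->
  (forall x y, A (x, y) -> D1 O O x y = B1 x y /\ D2 O O x y = B2 x y) ->
  (forall p q x y, (p + q < k)%nat -> A (x, y) ->
     is_derive (fun t => D1 p q t y) x (D1 (S p) q x y) /\
     is_derive (fun t => D1 p q x t) y (D1 p (S q) x y)) ->
  (forall p q x y, (p + q < k)%nat -> A (x, y) ->
     is_derive (fun t => D2 p q t y) x (D2 (S p) q x y) /\
     is_derive (fun t => D2 p q x t) y (D2 p (S q) x y)) ->
  (forall x y, A (x, y) ->
     Derive (fun t => B1 t y) x + Derive (fun t => B2 x t) y = 0) ->
  forall p q x y, (p + q < k)%nat -> A (x, y) ->
    D1 (S p) q x y + D2 p (S q) x y = 0.
Proof.
  intros HA H0 Hd1 Hd2 Hdiv.
  assert (Hzero : forall (f : R -> R) x l,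
    locally x (fun t => f t = 0) -> is_derive f x l -> l = 0).
  { intros f x l Hf Hl; rewrite <- (is_derive_unique _ _ _ Hl).
    rewrite (Derive_ext_loc f (fun _ => 0)) by exact Hf; apply Derive_const. }
  induction p as [|p IHp].
  - induction q as [|q IHq]; intros x y Hk Hz.
    + rewrite <- (Hdiv x y Hz).
      destruct (open_slices A x y HA Hz) as [Hsx Hsy].
      f_equal; symmetry; apply is_derive_unique.
      * apply (is_derive_ext_loc (fun t => D1 O O t y)); [|apply Hd1; auto].
        apply filter_imp with (2 := Hsx); intros t Ht; apply (H0 _ _ Ht).
      * apply (is_derive_ext_loc (fun t => D2 O O x t)); [|apply Hd2; auto].
        apply filter_imp with (2 := Hsy); intros t Ht; apply (H0 _ _ Ht).
    + destruct (open_slices A x y HA Hz) as [_ Hsy].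
      apply (Hzero (fun t => D1 1%nat q x t + D2 O (S q) x t) y).
      * apply filter_imp with (2 := Hsy); intros t Ht; apply IHq; [lia | exact Ht].
      * apply (@is_derive_plus R_AbsRing R_NormedModule);
          [apply Hd1 | apply Hd2]; auto; lia.
  - intros q x y Hk Hz.
    destruct (open_slices A x y HA Hz) as [Hsx _].
    apply (Hzero (fun t => D1 (S p) q t y + D2 p (S q) t y) x).
    + apply filter_imp with (2 := Hsx); intros t Ht; apply IHp; [lia | exact Ht].
    + apply (@is_derive_plus R_AbsRing R_NormedModule);
        [apply Hd1 | apply Hd2]; auto; lia.
Qed.

(** * The outflow of a cell *)

Definition jump (n : nat) (a : R) : R := a ^ n - (- a) ^ n.

(** The average of t^n over [-a, a]. *)
Definition mean_pow (n : nat) (a : R) : R := jump (S n) a / (2 * a * INR (S n)).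

(** dx dy times the discrete divergence.  Clearing the denominators gains the
    factor h that keeps the estimates free of the aspect ratio dx / dy. *)
Definition outflow (Q : nat) (w : nat -> R) (dx dy : R) (V1 V2 : side -> nat -> R) : R :=
  sum_n_m (fun mu => w mu *
    (dy * (V1 upper mu - V1 lower mu) + dx * (V2 upper mu - V2 lower mu))) 1 Q.

(** The divergence theorem for a divergence-free Taylor polynomial on the cell
    [-a, a] x [-b, b].  Both fluxes expand in the products
    jump (p+1) a * jump (q+1) b, with coefficients proportional to
    [d1 (S p) q] and [d2 p (S q)]; the terms with [jump 0] vanish. *)
Lemma tpoly_flux_zero k (d1 d2 : nat -> nat -> R) a b :
  0 < a -> 0 < b ->
  (forall p q, (p + q < k)%nat -> d1 (S p) q + d2 p (S q) = 0) ->
  b * psum (S k) (fun p => psum (S k - p) (fun q =>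
    d1 p q / (INR (fact p) * INR (fact q)) * jump p a * mean_pow q b)) +
  a * psum (S k) (fun p => psum (S k - p) (fun q =>
    d2 p q / (INR (fact p) * INR (fact q)) * mean_pow p a * jump q b)) = 0.
Proof.
  intros Ha Hb Hdiv.
  pose (G := fun p q => jump (S p) a * jump (S q) b /
    (2 * INR (fact (S p)) * INR (fact (S q)))).
  assert (HfS : forall n, INR (fact (S n)) = INR (S n) * INR (fact n)).
  { intros n; rewrite fact_simpl, mult_INR; reflexivity. }
  assert (Hj0 : forall c, jump 0 c = 0) by (intros; unfold jump; simpl; ring).
  assert (E1 : b * psum (S k) (fun p => psum (S k - p) (fun q =>
    d1 p q / (INR (fact p) * INR (fact q)) * jump p a * mean_pow q b)) =
    psum k (fun p => psum (k - p) (fun q => d1 (S p) q * G p q))).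
  { cbn [psum].
    rewrite (psum_zero (S k - 0)) by (intros; rewrite Hj0; ring).
    rewrite Rplus_0_l, <- psum_scal.
    apply psum_ext; intros p Hp.
    rewrite <- psum_scal.
    change (S k - S p)%nat with (k - p)%nat.
    apply psum_ext; intros q Hq.
    unfold G, mean_pow; rewrite (HfS q).
    field; repeat split; try apply INR_fact_neq_0; try lra.
    apply not_0_INR; lia. }
  assert (E2 : a * psum (S k) (fun p => psum (S k - p) (fun q =>
    d2 p q / (INR (fact p) * INR (fact q)) * mean_pow p a * jump q b)) =
    psum k (fun p => psum (k - p) (fun q => d2 p (S q) * G p q))).
  { rewrite psum_recr.
    replace (S k - k)%nat with 1%nat by lia.
    rewrite (psum_zero 1).
    2:{ intros q Hq; replace q with O by lia; rewrite Hj0; ring. }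
    rewrite Rplus_0_r, <- psum_scal.
    apply psum_ext; intros p Hp.
    rewrite <- psum_scal.
    replace (S k - p)%nat with (S (k - p)) by lia.
    cbn [psum]; rewrite Hj0, Rmult_0_r, Rmult_0_r, Rplus_0_l.
    apply psum_ext; intros q Hq.
    unfold G, mean_pow; rewrite (HfS p).
    field; repeat split; try apply INR_fact_neq_0; try lra.
    apply not_0_INR; lia. }
  rewrite E1, E2, <- psum_plus.
  apply psum_zero; intros p Hp; rewrite <- psum_plus.
  apply psum_zero; intros q Hq.
  rewrite <- Rmult_plus_distr_r, Hdiv by lia; ring.
Qed.

Lemma outflow_perturb Q w dx dy V1 V2 U1 U2 e :
  0 < dx -> 0 < dy ->
  (forall s mu, (1 <= mu <= Q)%nat -> Rabs (V1 s mu - U1 s mu) <= e) ->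
  (forall s mu, (1 <= mu <= Q)%nat -> Rabs (V2 s mu - U2 s mu) <= e) ->
  Rabs (outflow Q w dx dy V1 V2 - outflow Q w dx dy U1 U2) <=
    psum Q (fun i => Rabs (w (S i))) * (2 * (dx + dy) * e).
Proof.
  intros Hdx Hdy H1 H2; unfold outflow.
  rewrite !sum_n_m_psum, <- psum_minus, Rmult_comm, <- psum_scal.
  apply psum_abs_le; intros i Hi.
  match goal with |- Rabs ?x <= _ =>
    replace x with (w (S i) *
      (dy * ((V1 upper (S i) - U1 upper (S i)) - (V1 lower (S i) - U1 lower (S i)))
     + dx * ((V2 upper (S i) - U2 upper (S i)) - (V2 lower (S i) - U2 lower (S i)))))
     by ring end.
  rewrite Rabs_mult, Rmult_comm.
  apply Rmult_le_compat_r; [apply Rabs_pos|].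
  assert (A1 := H1 upper (S i) ltac:(lia)); assert (A2 := H1 lower (S i) ltac:(lia)).
  assert (A3 := H2 upper (S i) ltac:(lia)); assert (A4 := H2 lower (S i) ltac:(lia)).
  eapply Rle_trans; [apply Rabs_triang|].
  rewrite !Rabs_mult, (Rabs_pos_eq dx), (Rabs_pos_eq dy) by lra.
  assert (forall u v, Rabs u <= e -> Rabs v <= e -> Rabs (u - v) <= 2 * e).
  { intros u v Hu Hv; split_Rabs; lra. }
  replace (2 * (dx + dy) * e) with (dy * (2 * e) + dx * (2 * e)) by ring.
  apply Rplus_le_compat; apply Rmult_le_compat_l; auto; lra.
Qed.

Definition moment (Q : nat) (w z : nat -> R) (n : nat) : R :=
  sum_n_m (fun mu => w mu * z mu ^ n) 1 Q.

Lemma outflow_tpoly k Q w d1 d2 a b (X Y : nat -> R) :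
  outflow Q w (2 * a) (2 * b)
    (fun s mu => tpoly k d1 (sgn s * a) (Y mu))
    (fun s mu => tpoly k d2 (X mu) (sgn s * b)) =
  2 * (b * psum k (fun p => psum (k - p) (fun q =>
    d1 p q / (INR (fact p) * INR (fact q)) * jump p a * moment Q w Y q)) +
  a * psum k (fun p => psum (k - p) (fun q =>
    d2 p q / (INR (fact p) * INR (fact q)) * moment Q w X p * jump q b))).
Proof.
  unfold outflow, moment, tpoly, jump; rewrite sum_n_m_psum; cbn [sgn].
  rewrite Rmult_plus_distr_l, <- !Rmult_assoc.
  rewrite <- !psum_scal.
  match goal with |- _ = ?r =>
    transitivity (psum k (fun p => psum (k - p) (fun q => psum Q (fun i =>
     w (S i) * (2 * b * (d1 p q / (INR (fact p) * INR (fact q)) *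
       (a ^ p - (- a) ^ p) * Y (S i) ^ q) +
     2 * a * (d2 p q / (INR (fact p) * INR (fact q)) *
       X (S i) ^ p * (b ^ q - (- b) ^ q))))))) end.
  - erewrite (psum_ext k); [|intros p _; apply psum_swap].
    rewrite psum_swap.
    apply psum_ext; intros i _.
    rewrite <- !psum_minus, <- !psum_scal, <- psum_plus, <- psum_scal.
    apply psum_ext; intros p _.
    rewrite <- !psum_minus, <- !psum_scal, <- psum_plus, <- psum_scal.
    apply psum_ext; intros q _.
    rewrite !Rmult_1_l; replace (-1 * a) with (- a) by ring;
      replace (-1 * b) with (- b) by ring; ring.
  - rewrite <- psum_plus; apply psum_ext; intros p _.
    rewrite <- !psum_scal, <- psum_plus; apply psum_ext; intros q _.
    rewrite !sum_n_m_psum.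
    match goal with |- _ = ?c1 * (?c2 * psum Q ?f) + ?c3 * (?c4 * psum Q ?g * ?c5) =>
      transitivity ((c1 * c2) * psum Q f + (c3 * c4 * c5) * psum Q g); [|ring] end.
    rewrite <- !psum_scal, <- psum_plus; apply psum_ext; intros i _; ring.
Qed.

Lemma jump_abs_le n a : 0 <= a <= 1 -> Rabs (jump n a) <= 2.
Proof.
  intros Ha; unfold jump.
  assert (H : forall x, Rabs x <= 1 -> Rabs (x ^ n) <= 1).
  { intros x Hx; rewrite <- RPow_abs, <- (pow1 n).
    apply pow_incr; split; [apply Rabs_pos | exact Hx]. }
  assert (H1 := H a ltac:(split_Rabs; lra)).
  assert (H2 := H (- a) ltac:(split_Rabs; lra)).
  split_Rabs; lra.
Qed.

Lemma taylor_coef_le (d : R) p q K :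
  Rabs d <= K -> Rabs (d / (INR (fact p) * INR (fact q))) <= K.
Proof.
  intros Hd.
  assert (H : 1 <= INR (fact p) * INR (fact q)).
  { rewrite <- mult_INR; change 1 with (INR 1); apply le_INR.
    generalize (lt_O_fact p) (lt_O_fact q); nia. }
  unfold Rdiv; rewrite Rabs_mult, Rabs_inv, (Rabs_pos_eq (_ * _)) by lra.
  apply Rle_trans with (2 := Hd).
  rewrite <- (Rmult_1_r (Rabs d)) at 2.
  apply Rmult_le_compat_l; [apply Rabs_pos|].
  rewrite <- Rinv_1; apply Rinv_le_contravar; lra.
Qed.

(** Only the deviation of the discrete moments from the true averages
    contributes, since with the true averages the outflow is zero.  The bounds
    on [a] and [b] serve to bound the jumps. *)
Lemma outflow_tpoly_small k Q w d1 d2 a b (X Y : nat -> R) K e :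
  0 < a <= 1 -> 0 < b <= 1 ->
  (forall p q, (p + q < k)%nat -> d1 (S p) q + d2 p (S q) = 0) ->
  (forall p q, (p + q <= k)%nat -> Rabs (d1 p q) <= K) ->
  (forall p q, (p + q <= k)%nat -> Rabs (d2 p q) <= K) ->
  (forall n, (n <= k)%nat -> Rabs (moment Q w Y n - mean_pow n b) <= e) ->
  (forall n, (n <= k)%nat -> Rabs (moment Q w X n - mean_pow n a) <= e) ->
  Rabs (outflow Q w (2 * a) (2 * b)
    (fun s mu => tpoly (S k) d1 (sgn s * a) (Y mu))
    (fun s mu => tpoly (S k) d2 (X mu) (sgn s * b))) <=
  2 * (a + b) * (INR (S k) * (INR (S k) * (K * 2 * e))).
Proof.
  intros Ha Hb Hdiv HK1 HK2 HY HX.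
  assert (He : 0 <= e).
  { eapply Rle_trans; [apply Rabs_pos | apply (HY O); lia]. }
  assert (HK : 0 <= K).
  { eapply Rle_trans; [apply Rabs_pos | apply (HK1 O O); lia]. }
  assert (Hprod : forall c u v, Rabs c <= K -> Rabs u <= 2 -> Rabs v <= e ->
    Rabs (c * u * v) <= K * 2 * e).
  { intros c u v Hc Hu Hv; rewrite !Rabs_mult.
    apply Rmult_le_compat; [| apply Rabs_pos | | exact Hv].
    - apply Rmult_le_pos; apply Rabs_pos.
    - apply Rmult_le_compat; auto using Rabs_pos. }
  assert (Hsum : forall F, (forall p q, (p + q <= k)%nat ->
      Rabs (F p q) <= K * 2 * e) ->
    Rabs (psum (S k) (fun p => psum (S k - p) (F p))) <=
      INR (S k) * (INR (S k) * (K * 2 * e))).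
  { intros F HF; apply psum_abs_le_const; intros p Hp.
    apply Rle_trans with (INR (S k - p) * (K * 2 * e)).
    - apply psum_abs_le_const; intros q Hq; apply HF; lia.
    - apply Rmult_le_compat_r; [|apply le_INR; lia].
      apply Rmult_le_pos; lra. }
  rewrite outflow_tpoly.
  rewrite <- (Rminus_0_r (_ + _)),
    <- (tpoly_flux_zero k d1 d2 a b (proj1 Ha) (proj1 Hb) Hdiv).
  match goal with |- Rabs (2 * (b * ?s1 + a * ?s2 - (b * ?t1 + a * ?t2))) <= _ =>
    replace (2 * (b * s1 + a * s2 - (b * t1 + a * t2)))
      with (2 * (b * (s1 - t1) + a * (s2 - t2))) by ring;
    assert (A1 : Rabs (s1 - t1) <= INR (S k) * (INR (S k) * (K * 2 * e)));
    [|assert (A2 : Rabs (s2 - t2) <= INR (S k) * (INR (S k) * (K * 2 * e)))]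
  end.
  - rewrite <- psum_minus.
    erewrite psum_ext; [|intros p _; rewrite <- psum_minus; reflexivity].
    apply Hsum; intros p q Hpq.
    rewrite <- Rmult_minus_distr_l.
    apply Hprod; [apply taylor_coef_le, HK1; lia | apply jump_abs_le; lra | apply HY; lia].
  - rewrite <- psum_minus.
    erewrite psum_ext; [|intros p _; rewrite <- psum_minus; reflexivity].
    apply Hsum; intros p q Hpq.
    match goal with |- Rabs (?c * ?m * ?j - ?c * ?m' * ?j) <= _ =>
      replace (c * m * j - c * m' * j) with (c * j * (m - m')) by ring end.
    apply Hprod; [apply taylor_coef_le, HK2; lia | apply jump_abs_le; lra | apply HX; lia].
  - rewrite Rabs_mult, (Rabs_pos_eq 2) by lra.
    rewrite Rmult_assoc; apply Rmult_le_compat_l; [lra|].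
    eapply Rle_trans; [apply Rabs_triang|].
    rewrite !Rabs_mult, (Rabs_pos_eq a), (Rabs_pos_eq b) by lra.
    rewrite (Rplus_comm a b), Rmult_plus_distr_r.
    apply Rplus_le_compat; apply Rmult_le_compat_l; lra.
Qed.

Lemma div_h_outflow m Q w V1 V2 i j :
  div_h m Q w V1 V2 i j =
  outflow Q w (mesh_dx m) (mesh_dy m) (fun s => V1 s i j) (fun s => V2 s i j) /
    (mesh_dx m * mesh_dy m).
Proof.
  assert (Hx := mesh_dx_pos m); assert (Hy := mesh_dy_pos m).
  unfold div_h, outflow, Rdiv; rewrite !sum_n_m_psum, Rmult_comm, <- psum_scal.
  apply psum_ext; intros mu _; field; lra.
Qed.

Lemma correction_factor_le dx dy : 0 < dx -> 0 < dy ->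
  Rmax dx dy * (dy / (2 * (dx ^ 2 + dy ^ 2))) <= 1.
Proof.
  intros Hx Hy.
  apply (Rmult_le_reg_r (2 * (dx ^ 2 + dy ^ 2))); [nra|].
  replace (Rmax dx dy * (dy / (2 * (dx ^ 2 + dy ^ 2))) * (2 * (dx ^ 2 + dy ^ 2)))
    with (Rmax dx dy * dy) by (field; nra).
  unfold Rmax; destruct (Rle_dec dx dy); nra.
Qed.

(** The denominators 1 + (dx/dy)^2 and 1 + (dy/dx)^2 are what makes both
    corrections insensitive to the aspect ratio. *)
Lemma corrections_le m Q w V1 V2 i j e :
  Rabs (outflow Q w (mesh_dx m) (mesh_dy m) (fun s => V1 s i j) (fun s => V2 s i j))
    <= mesh_h m * e ->
  Rabs (corr1 m Q w V1 V2 i j) <= e /\ Rabs (corr2 m Q w V1 V2 i j) <= e.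
Proof.
  intros H.
  assert (Hx := mesh_dx_pos m); assert (Hy := mesh_dy_pos m).
  assert (Hh : 0 < mesh_h m).
  { unfold mesh_h; eapply Rlt_le_trans; [exact Hx | apply Rmax_l]. }
  assert (He : 0 <= e).
  { apply (Rmult_le_reg_l _ _ _ Hh); rewrite Rmult_0_r.
    eapply Rle_trans; [apply Rabs_pos | exact H]. }
  unfold corr1, corr2; rewrite div_h_outflow.
  set (F := outflow _ _ _ _ _ _) in *.
  assert (Hgen : forall c, 0 <= c -> mesh_h m * c <= 1 -> Rabs (F * c) <= e).
  { intros c Hc Hc1; rewrite Rabs_mult, (Rabs_pos_eq c) by exact Hc.
    apply Rle_trans with (mesh_h m * e * c).
    - apply Rmult_le_compat_r; assumption.
    - replace (mesh_h m * e * c) with (e * (mesh_h m * c)) by ring.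
      rewrite <- (Rmult_1_r e) at 2; apply Rmult_le_compat_l; assumption. }
  assert (Hfac := correction_factor_le _ _ Hx Hy).
  assert (Hfac' := correction_factor_le _ _ Hy Hx).
  revert H Hh Hgen; unfold mesh_h in *; set (dx := mesh_dx m) in *; set (dy := mesh_dy m) in *.
  intros H Hh Hgen.
  split.
  - replace (dx * (F / (dx * dy)) / (2 * (1 + (dx / dy) ^ 2)))
      with (F * (dy / (2 * (dx ^ 2 + dy ^ 2)))) by (field; repeat split; nra).
    apply Hgen; [|exact Hfac].
    apply Rdiv_le_0_compat; nra.
  - replace (dy * (F / (dx * dy)) / (2 * (1 + (dy / dx) ^ 2)))
      with (F * (dx / (2 * (dy ^ 2 + dx ^ 2)))) by (field; repeat split; nra).
    apply Hgen; [|rewrite Rmax_comm; exact Hfac'].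
    apply Rdiv_le_0_compat; nra.
Qed.

(** * Errors uniform over the meshes *)

Lemma bigO_h_psum {T : Type} (M : T -> mesh) Q k n (e : nat -> T -> Z -> Z -> nat -> R) :
  (forall l, (l < n)%nat -> bigO_h M Q k (e l)) ->
  bigO_h M Q k (fun t i j mu => psum n (fun l => Rabs (e l t i j mu))).
Proof.
  induction n as [|n IH]; intros H.
  - exists 0, 1; split; [lra|]; intros; simpl; rewrite Rabs_R0; lra.
  - destruct IH as [C [h0 [Hh0 HC]]]; [intros; apply H; lia|].
    destruct (H n ltac:(lia)) as [C' [h0' [Hh0' HC']]].
    exists (C + C'), (Rmin h0 h0'); split; [apply Rmin_pos; assumption|].
    intros t i j mu Hh Hc Hmu.
    assert (H1 := HC t i j mu (Rle_trans _ _ _ Hh (Rmin_l _ _)) Hc Hmu).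
    assert (H2 := HC' t i j mu (Rle_trans _ _ _ Hh (Rmin_r _ _)) Hc Hmu).
    rewrite psum_recr, Rmult_plus_distr_r.
    eapply Rle_trans; [apply Rabs_triang|]; rewrite Rabs_Rabsolu; lra.
Qed.

Lemma bigO_h_common {T : Type} (M : T -> mesh) Q k n (e : nat -> T -> Z -> Z -> nat -> R) :
  (forall l, (l < n)%nat -> bigO_h M Q k (e l)) ->
  exists C h0 : R, 0 < h0 /\
    forall l t i j mu, (l < n)%nat -> mesh_h (M t) <= h0 -> mesh_cell (M t) i j ->
      (1 <= mu <= Q)%nat -> Rabs (e l t i j mu) <= C * mesh_h (M t) ^ k.
Proof.
  intros H; destruct (bigO_h_psum M Q k n e H) as [C [h0 [Hh0 HC]]].
  exists C, h0; split; [exact Hh0|]; intros l t i j mu Hl Hh Hc Hmu.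
  eapply Rle_trans; [|apply (HC t i j mu Hh Hc Hmu)].
  eapply Rle_trans; [|apply Rle_abs].
  apply (psum_ge_term n (fun l => Rabs (e l t i j mu))); auto using Rabs_pos.
Qed.

(** The coefficient [c] may depend on the mesh and the cell, as long as it is
    bounded: this is how fixed test functions yield cell-dependent ones. *)
Lemma bigO_h_lincomb {T : Type} (M : T -> mesh) Q k (u v g : T -> Z -> Z -> nat -> R)
    (c : T -> Z -> Z -> R) r :
  bigO_h M Q k u -> bigO_h M Q k v ->
  (forall t i j, mesh_cell (M t) i j -> Rabs (c t i j) <= r) ->
  (forall t i j mu, g t i j mu = u t i j mu - c t i j * v t i j mu) ->
  bigO_h M Q k g.
Proof.
  intros [C [h0 [Hh0 HC]]] [C' [h0' [Hh0' HC']]] Hc Hg.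
  exists (C + r * C'), (Rmin h0 h0'); split; [apply Rmin_pos; assumption|].
  intros t i j mu Hh Hcell Hmu.
  assert (H1 := HC t i j mu (Rle_trans _ _ _ Hh (Rmin_l _ _)) Hcell Hmu).
  assert (H2 := HC' t i j mu (Rle_trans _ _ _ Hh (Rmin_r _ _)) Hcell Hmu).
  specialize (Hc t i j Hcell).
  rewrite Hg, Rmult_plus_distr_r, Rmult_assoc.
  unfold Rminus; eapply Rle_trans; [apply Rabs_triang|].
  rewrite Rabs_Ropp, Rabs_mult.
  apply Rplus_le_compat; [exact H1|].
  apply Rmult_le_compat; auto using Rabs_pos.
Qed.

(** * Quadrature of centred monomials *)

Lemma Ck_line_pow k n : Ck_line k (fun x => x ^ n).
Proof.
  assert (Hpow : forall (c : R) m x, continuous (fun t : R => c * t ^ m) x).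
  { intros c m x; apply (@ex_derive_continuous R_AbsRing R_NormedModule).
    auto_derive; trivial. }
  intros l x _; destruct (Compare_dec.le_lt_dec l n) as [Hl|Hl].
  - assert (HD := fun t => is_derive_n_pow_smalli l n t Hl); split.
    + destruct l; [exact I|]; eexists; apply (HD x).
    + eapply continuous_ext; [|apply (Hpow (INR (fact n) / INR (fact (n - l))) (n - l)%nat)].
      intros t; symmetry; apply is_derive_n_unique, HD.
  - assert (HD := fun t => is_derive_n_pow_bigi l n t Hl); split.
    + destruct l; [exact I|]; eexists; apply (HD x).
    + eapply continuous_ext; [|apply (continuous_const 0)].
      intros t; symmetry; apply is_derive_n_unique, HD.
Qed.

Lemma continuous_centred_monomial n m c x :
  continuous (fun y : R => y ^ n * (y - c) ^ m) x.
Proof.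
  apply (@ex_derive_continuous R_AbsRing R_NormedModule); auto_derive; trivial.
Qed.

Lemma quad_error_ext Q w f g z a b :
  (forall y, f y = g y) -> quad_error Q w f z a b = quad_error Q w g z a b.
Proof.
  intros H; unfold quad_error; f_equal.
  - apply sum_n_m_ext; intros; rewrite H; reflexivity.
  - f_equal; apply RInt_ext; intros; apply H.
Qed.

Lemma quad_error_shift Q w z a b c n m :
  quad_error Q w (fun y => y ^ n * (y - c) ^ S m) z a b =
  quad_error Q w (fun y => y ^ S n * (y - c) ^ m) z a b -
  c * quad_error Q w (fun y => y ^ n * (y - c) ^ m) z a b.
Proof.
  assert (Hex : forall n m, ex_RInt (fun y => y ^ n * (y - c) ^ m) a b).
  { intros; apply (@ex_RInt_continuous R_CompleteNormedModule).
    intros; apply continuous_centred_monomial. }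
  assert (HI : RInt (fun y => y ^ n * (y - c) ^ S m) a b =
    RInt (fun y => y ^ S n * (y - c) ^ m) a b - c * RInt (fun y => y ^ n * (y - c) ^ m) a b).
  { transitivity (RInt (fun y => minus (y ^ S n * (y - c) ^ m)
      (scal c (y ^ n * (y - c) ^ m))) a b).
    - apply RInt_ext; intros y _; unfold minus, plus, opp, scal; simpl;
        unfold mult; simpl; ring.
    - etransitivity; [apply (@RInt_minus R_CompleteNormedModule)|].
      + apply Hex.
      + apply (@ex_RInt_scal R_CompleteNormedModule), Hex.
      + apply (f_equal (Rminus _)), (@RInt_scal R_CompleteNormedModule), Hex. }
  unfold quad_error; rewrite HI, !sum_n_m_psum.
  rewrite (psum_ext Q _ (fun mu => w (S mu) * (z (S mu) ^ S n * (z (S mu) - c) ^ m) -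
    c * (w (S mu) * (z (S mu) ^ n * (z (S mu) - c) ^ m)))) by (intros; simpl; ring).
  rewrite psum_minus, psum_scal; ring.
Qed.

(** Only the powers y^n are test functions independent of the cell.  The
    identity y^n (y-c)^(m+1) = y^(n+1) (y-c)^m - c y^n (y-c)^m trades centred
    factors for powers, which avoids the binomial expansion; the induction on
    [m] therefore needs all [n] at once. *)
Lemma quad_error_centred_monomial_bigO {T : Type} (M : T -> mesh) Q k w
    (z : T -> Z -> Z -> nat -> R) (a b c : T -> Z -> Z -> R) r :
  (forall f, Ck_line k f -> bigO_h M Q k (fun t i j _ =>
     quad_error Q w f (z t i j) (a t i j) (b t i j))) ->
  (forall t i j, mesh_cell (M t) i j -> Rabs (c t i j) <= r) ->
  forall m n, bigO_h M Q k (fun t i j _ =>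
    quad_error Q w (fun y => y ^ n * (y - c t i j) ^ m) (z t i j) (a t i j) (b t i j)).
Proof.
  intros Hq Hc; induction m as [|m IH]; intros n.
  - destruct (Hq _ (Ck_line_pow k n)) as [C [h0 [Hh0 HC]]].
    exists C, h0; split; [exact Hh0|]; intros t i j mu Hh Hcell Hmu.
    specialize (HC t i j mu Hh Hcell Hmu).
    rewrite (quad_error_ext Q w _ (fun y => y ^ n)) by (intros; simpl; ring).
    exact HC.
  - eapply (bigO_h_lincomb M Q k _ _ _ c r (IH (S n)) (IH n) Hc).
    intros t i j mu; apply quad_error_shift.
Qed.

(** The factor y^0 matches the shape of [quad_error_centred_monomial_bigO]. *)
Lemma quad_error_moment Q w z c b n : 0 < b ->
  quad_error Q w (fun y => y ^ 0 * (y - c) ^ n) z (c - b) (c + b) =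
  moment Q w (fun mu => z mu - c) n - mean_pow n b.
Proof.
  intros Hb; unfold quad_error, moment, mean_pow, jump.
  f_equal; [apply sum_n_m_ext; intros; simpl; ring|].
  assert (Hn : INR (S n) <> 0) by (apply not_0_INR; lia).
  rewrite (is_RInt_unique _ _ _
    (minus ((c + b - c) ^ S n / INR (S n)) ((c - b - c) ^ S n / INR (S n)))).
  - unfold minus, plus, opp; cbn [AbelianGroup.opp AbelianMonoid.plus]; simpl opp; simpl plus.
    change (/ (c + b - (c - b)) * ((c + b - c) ^ S n / INR (S n) +
      - ((c - b - c) ^ S n / INR (S n))) = (b ^ S n - (- b) ^ S n) / (2 * b * INR (S n))).
    replace (c + b - c) with b by ring; replace (c - b - c) with (- b) by ring.
    field; split; lra.
  - apply (@is_RInt_derive R_CompleteNormedModule (fun y => (y - c) ^ S n / INR (S n))).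
    + intros y _.
      apply (is_derive_ext (fun y => / INR (S n) * (y - c) ^ S n)).
      { intros t; unfold Rdiv; apply Rmult_comm. }
      replace (y ^ 0 * (y - c) ^ n)
        with (/ INR (S n) * (INR (S n) * 1 * (y - c) ^ pred (S n)))
        by (rewrite pow_O; simpl pred; field; exact Hn).
      apply is_derive_scal, (is_derive_pow (fun t => t - c)).
      auto_derive; [trivial | ring].
    + intros y _; apply continuous_centred_monomial.
Qed.

(** * Estimates on a cell *)

Definition xcentre (m : mesh) (i : Z) : R := mesh_x0 m + IZR i * mesh_dx m.
Definition ycentre (m : mesh) (j : Z) : R := mesh_y0 m + IZR j * mesh_dy m.

Lemma xhalf_centre m s i : xhalf m s i = xcentre m i + sgn s * (mesh_dx m / 2).
Proof. unfold xhalf, xcentre; field. Qed.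

Lemma yhalf_centre m s j : yhalf m s j = ycentre m j + sgn s * (mesh_dy m / 2).
Proof. unfold yhalf, ycentre; field. Qed.

Lemma centre_open_cell m i j : open_cell m i j (xcentre m i, ycentre m j).
Proof.
  assert (Hx := mesh_dx_pos m); assert (Hy := mesh_dy_pos m).
  split; rewrite ?xhalf_centre, ?yhalf_centre; simpl; lra.
Qed.

Lemma taylor_closed_cell k Omega B (D : nat -> nat -> R -> R -> R) K :
  (forall x y, adherent Omega (x, y) -> D O O x y = B x y) ->
  (forall p q z, (p + q <= k)%nat -> adherent Omega z ->
     continuous_within (adherent Omega) (D p q) z) ->
  (forall p q x y, (p + q < k)%nat -> Omega (x, y) ->
     is_derive (fun t => D p q t y) x (D (S p) q x y) /\
     is_derive (fun t => D p q x t) y (D p (S q) x y)) ->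
  (forall p q x y, (p + q <= k)%nat -> Omega (x, y) -> Rabs (D p q x y) <= K) ->
  forall m i j x y, (forall z, open_cell m i j z -> Omega z) ->
  closed_cell m i j (x, y) ->
  Rabs (B x y - tpoly k (fun p q => D p q (xcentre m i) (ycentre m j))
      (x - xcentre m i) (y - ycentre m j)) <= (1 + INR k) * K * mesh_h m ^ k.
Proof.
  intros HB Hc Hd HK m i j x y Hcell Hxy.
  assert (Hadh := closed_cell_adherent m i j _ Hxy).
  assert (HadhO := adherent_mono _ _ _ Hcell Hadh).
  rewrite <- HB by exact HadhO.
  apply (continuous_within_bound (adherent Omega) (open_cell m i j) (D O O)
    (fun x y => tpoly k (fun p q => D p q (xcentre m i) (ycentre m j))
      (x - xcentre m i) (y - ycentre m j)) (x, y)).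
  - apply Hc; [lia | exact HadhO].
  - apply continuous_tpoly.
  - intros z Hz; apply adherent_incl, Hcell, Hz.
  - exact Hadh.
  - intros [u v] Huv.
    destruct (centre_open_cell m i j) as [Hcx Hcy].
    destruct Huv as [Hu Hv]; simpl in Hcx, Hcy, Hu, Hv |- *.
    apply (taylor2_remainder k D (xhalf m lower i) (xhalf m upper i)
      (yhalf m lower j) (yhalf m upper j)); auto.
    + intros p q s r Hpq Hs Hr; apply Hd; [exact Hpq | apply Hcell; split; assumption].
    + intros p q s r Hpq Hs Hr; apply HK; [exact Hpq | apply Hcell; split; assumption].
    + rewrite !xhalf_centre; simpl; unfold mesh_h.
      generalize (Rmax_l (mesh_dx m) (mesh_dy m)); lra.
    + rewrite !yhalf_centre; simpl; unfold mesh_h.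
      generalize (Rmax_r (mesh_dx m) (mesh_dy m)); lra.
Qed.

Lemma bigO_h_sides {T : Type} (M : T -> mesh) Q k (e : side -> T -> Z -> Z -> nat -> R) :
  (forall s, bigO_h M Q k (e s)) ->
  exists C h0 : R, 0 < h0 /\
    forall s t i j mu, mesh_h (M t) <= h0 -> mesh_cell (M t) i j ->
      (1 <= mu <= Q)%nat -> Rabs (e s t i j mu) <= C * mesh_h (M t) ^ k.
Proof.
  intros H.
  destruct (bigO_h_common M Q k 2
    (fun l => match l with O => e upper | _ => e lower end)) as [C [h0 [Hh0 HC]]].
  - intros [|l] _; apply H.
  - exists C, h0; split; [exact Hh0|]; intros [|] t i j mu.
    + apply (HC O); lia.
    + apply (HC 1%nat); lia.
Qed.

(** The two sources of error on one cell: [e1] bounds the distance of the edge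
    values from the Taylor polynomials, [e2] the quadrature error of the centred
    monomials.  The restriction on h makes the half widths at most one. *)
Lemma corrections_cell_bound m Q w V1 V2 i j k d1 d2 (xm ym : nat -> R) K e1 e2 :
  mesh_h m <= 2 ->
  (forall p q, (p + q < k)%nat -> d1 (S p) q + d2 p (S q) = 0) ->
  (forall p q, (p + q <= k)%nat -> Rabs (d1 p q) <= K) ->
  (forall p q, (p + q <= k)%nat -> Rabs (d2 p q) <= K) ->
  (forall s mu, (1 <= mu <= Q)%nat -> Rabs (V1 s i j mu -
     tpoly (S k) d1 (xhalf m s i - xcentre m i) (ym mu - ycentre m j)) <= e1) ->
  (forall s mu, (1 <= mu <= Q)%nat -> Rabs (V2 s i j mu -
     tpoly (S k) d2 (xm mu - xcentre m i) (yhalf m s j - ycentre m j)) <= e1) ->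
  (forall n, (n <= k)%nat -> Rabs (quad_error Q w
     (fun x => x ^ 0 * (x - xcentre m i) ^ n) xm (xhalf m lower i) (xhalf m upper i)) <= e2) ->
  (forall n, (n <= k)%nat -> Rabs (quad_error Q w
     (fun y => y ^ 0 * (y - ycentre m j) ^ n) ym (yhalf m lower j) (yhalf m upper j)) <= e2) ->
  0 <= e1 ->
  let C := 4 * psum Q (fun l => Rabs (w (S l))) * e1 +
           4 * INR (S k) ^ 2 * K * e2 in
  Rabs (corr1 m Q w V1 V2 i j) <= C /\ Rabs (corr2 m Q w V1 V2 i j) <= C.
Proof.
  intros Hh Hdiv HK1 HK2 HV1 HV2 HX HY He1 C.
  assert (Hdx := mesh_dx_pos m); assert (Hdy := mesh_dy_pos m).
  assert (Hxh : mesh_dx m <= mesh_h m) by apply Rmax_l.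
  assert (Hyh : mesh_dy m <= mesh_h m) by apply Rmax_r.
  set (a := mesh_dx m / 2); set (b := mesh_dy m / 2).
  assert (HMX : forall n, (n <= k)%nat ->
    Rabs (moment Q w (fun mu => xm mu - xcentre m i) n - mean_pow n a) <= e2).
  { intros n Hn; rewrite <- quad_error_moment by (unfold a; lra).
    replace (xcentre m i - a) with (xhalf m lower i)
      by (rewrite xhalf_centre; unfold a; simpl; ring).
    replace (xcentre m i + a) with (xhalf m upper i)
      by (rewrite xhalf_centre; unfold a; simpl; ring).
    apply HX, Hn. }
  assert (HMY : forall n, (n <= k)%nat ->
    Rabs (moment Q w (fun mu => ym mu - ycentre m j) n - mean_pow n b) <= e2).
  { intros n Hn; rewrite <- quad_error_moment by (unfold b; lra).
    replace (ycentre m j - b) with (yhalf m lower j)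
      by (rewrite yhalf_centre; unfold b; simpl; ring).
    replace (ycentre m j + b) with (yhalf m upper j)
      by (rewrite yhalf_centre; unfold b; simpl; ring).
    apply HY, Hn. }
  assert (Hpoly := outflow_tpoly_small k Q w d1 d2 a b _ _ K e2
    ltac:(unfold a; lra) ltac:(unfold b; lra) Hdiv HK1 HK2 HMY HMX).
  set (P1 := fun (s : side) mu => tpoly (S k) d1 (sgn s * a) (ym mu - ycentre m j)) in Hpoly.
  set (P2 := fun (s : side) mu => tpoly (S k) d2 (xm mu - xcentre m i) (sgn s * b)) in Hpoly.
  assert (Hpert := outflow_perturb Q w (mesh_dx m) (mesh_dy m)
    (fun s => V1 s i j) (fun s => V2 s i j) P1 P2 e1 Hdx Hdy).
  replace (2 * a) with (mesh_dx m) in Hpoly by (unfold a; field).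
  replace (2 * b) with (mesh_dy m) in Hpoly by (unfold b; field).
  apply corrections_le.
  match type of Hpert with _ -> _ -> Rabs (?x - ?y) <= _ =>
    replace x with ((x - y) + y) by ring end.
  eapply Rle_trans; [apply Rabs_triang|].
  set (W := psum Q _) in *.
  assert (HW : 0 <= W).
  { unfold W; rewrite <- (Rabs_R0), <- (psum_zero Q (fun _ => 0)) by reflexivity.
    apply psum_abs_le; intros; rewrite Rabs_R0; apply Rabs_pos. }
  assert (HK : 0 <= K).
  { eapply Rle_trans; [apply Rabs_pos | apply (HK1 O O); lia]. }
  assert (He2 : 0 <= e2).
  { eapply Rle_trans; [apply Rabs_pos | apply (HMX O); lia]. }
  replace (mesh_h m * C) with
    (W * (2 * (2 * mesh_h m) * e1) +
     2 * mesh_h m * (INR (S k) * (INR (S k) * (K * 2 * e2)))) by (unfold C; ring).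
  apply Rplus_le_compat.
  - eapply Rle_trans; [apply Hpert|].
    + intros s mu Hmu; unfold P1.
      replace (sgn s * a) with (xhalf m s i - xcentre m i)
        by (rewrite xhalf_centre; unfold a; ring).
      apply HV1, Hmu.
    + intros s mu Hmu; unfold P2.
      replace (sgn s * b) with (yhalf m s j - ycentre m j)
        by (rewrite yhalf_centre; unfold b; ring).
      apply HV2, Hmu.
    + apply Rmult_le_compat_l; [exact HW|].
      apply Rmult_le_compat_r; [exact He1 | lra].
  - eapply Rle_trans; [exact Hpoly|].
    apply Rmult_le_compat_r; [|unfold a, b; lra].
    repeat apply Rmult_le_pos; try apply pos_INR; lra.
Qed.

Lemma edge_closed_cell1 m s i j y : yhalf m lower j <= y <= yhalf m upper j ->
  closed_cell m i j (xhalf m s i, y).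
Proof.
  intros Hy; assert (Hx := mesh_dx_pos m).
  split; simpl; [|exact Hy]; rewrite !xhalf_centre; destruct s; simpl; lra.
Qed.

Lemma edge_closed_cell2 m s i j x : xhalf m lower i <= x <= xhalf m upper i ->
  closed_cell m i j (x, yhalf m s j).
Proof.
  intros Hx; assert (Hy := mesh_dy_pos m).
  split; simpl; [exact Hx|]; rewrite !yhalf_centre; destruct s; simpl; lra.
Qed.

(** * The order of accuracy of the modified values *)

Theorem theorem2p7
  (k : nat) (Hk : (3 <= k)%nat)
  (Omega : R * R -> Prop) (HOmega : open Omega) (HOmegab : bounded_set Omega)
  (B1 B2 B3 : R -> R -> R)
  (HB1 : Ck_closure k Omega B1)
  (HB2 : Ck_closure k Omega B2)
  (HB3 : Ck_closure k Omega B3)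
  (Hdiv : forall x y, Omega (x, y) ->
     Derive (fun t => B1 t y) x + Derive (fun t => B2 x t) y = 0)
  (T : Type) (M : T -> mesh) (HM : forall t, partitions (M t) Omega)
  (Q : nat) (w : nat -> R) (Hw : sum_n_m w 1 Q = 1)
  (xq yq : T -> Z -> nat -> R)
  (Hxq : forall t i j mu, mesh_cell (M t) i j -> (1 <= mu <= Q)%nat ->
     xhalf (M t) lower i <= xq t i mu <= xhalf (M t) upper i)
  (Hyq : forall t i j mu, mesh_cell (M t) i j -> (1 <= mu <= Q)%nat ->
     yhalf (M t) lower j <= yq t j mu <= yhalf (M t) upper j)
  (Hxquad : forall f, Ck_line k f ->
     bigO_h M Q k (fun t i j _ =>
       quad_error Q w f (xq t i) (xhalf (M t) lower i) (xhalf (M t) upper i)))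
  (Hyquad : forall f, Ck_line k f ->
     bigO_h M Q k (fun t i j _ =>
       quad_error Q w f (yq t j) (yhalf (M t) lower j) (yhalf (M t) upper j)))
  (B1h B2h : T -> edge_values)
  (HB1h : forall s, bigO_h M Q k (fun t i j mu =>
     B1h t s i j mu - B1 (xhalf (M t) s i) (yq t j mu)))
  (HB2h : forall s, bigO_h M Q k (fun t i j mu =>
     B2h t s i j mu - B2 (xq t i mu) (yhalf (M t) s j))) :
  (forall s, bigO_h M Q k (fun t i j mu =>
     modified1 (M t) Q w (B1h t) (B2h t) s i j mu -
     B1 (xhalf (M t) s i) (yq t j mu))) /\
  (forall s, bigO_h M Q k (fun t i j mu =>
     modified2 (M t) Q w (B1h t) (B2h t) s i j mu -
     B2 (xq t i mu) (yhalf (M t) s j))).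
Proof.
  (* The centre of each cell lies in the bounded domain, which bounds both the
     Taylor coefficients and the shifts to centred monomials. *)
  assert (Hcorr : bigO_h M Q k (fun t i j _ => corr1 (M t) Q w (B1h t) (B2h t) i j) /\
                  bigO_h M Q k (fun t i j _ => corr2 (M t) Q w (B1h t) (B2h t) i j)).
  { destruct HB1 as [D1 [HD10 [HD1c HD1d]]], HB2 as [D2 [HD20 [HD2c HD2d]]].
    destruct (derivatives_bounded k Omega D1 HOmegab HD1c) as [K1 HK1].
    destruct (derivatives_bounded k Omega D2 HOmegab HD2c) as [K2 HK2].
    destruct HOmegab as [r Hr].
    assert (Hcell : forall t i j, mesh_cell (M t) i j ->
      forall z, open_cell (M t) i j z -> Omega z).
    { intros t i j Hc z; apply (proj1 (HM t) i j z Hc). }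
    assert (Hcentre : forall t i j, mesh_cell (M t) i j ->
      Omega (xcentre (M t) i, ycentre (M t) j)).
    { intros t i j Hc; apply (Hcell t i j Hc), centre_open_cell. }
    assert (Hdiv0 := div_free_derivatives k Omega B1 B2 D1 D2 HOmega
      (fun x y Hz => conj (HD10 x y (adherent_incl _ _ Hz))
                          (HD20 x y (adherent_incl _ _ Hz))) HD1d HD2d Hdiv).
    destruct (bigO_h_sides M Q k _ HB1h) as [C1 [h1 [Hh1 HC1]]].
    destruct (bigO_h_sides M Q k _ HB2h) as [C2 [h2 [Hh2 HC2]]].
    destruct (bigO_h_common M Q k k _ (fun n _ =>
      quad_error_centred_monomial_bigO M Q k w (fun t i _ => xq t i) _ _
        (fun t i _ => xcentre (M t) i) r Hxquad
        (fun t i j Hc => proj1 (Hr _ (Hcentre t i j Hc))) n 0%nat))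
      as [C3 [h3 [Hh3 HC3]]].
    destruct (bigO_h_common M Q k k _ (fun n _ =>
      quad_error_centred_monomial_bigO M Q k w (fun t _ j => yq t j) _ _
        (fun t _ j => ycentre (M t) j) r Hyquad
        (fun t i j Hc => proj2 (Hr _ (Hcentre t i j Hc))) n 0%nat))
      as [C4 [h4 [Hh4 HC4]]].
    destruct k as [|k']; [lia|].
    (* [E1] collects the reconstruction error and the Taylor remainder, [E2]
       the quadrature errors; both are in units of h^k. *)
    pose (K := Rmax K1 K2).
    pose (E1 := Rmax C1 C2 + (1 + INR (S k')) * K).
    pose (E2 := Rmax C3 C4).
    pose (C := 4 * psum Q (fun l => Rabs (w (S l))) * E1 +
               4 * INR (S k') ^ 2 * K * E2).
    assert (Hall : forall t i j mu,
      mesh_h (M t) <= Rmin 2 (Rmin (Rmin h1 h2) (Rmin h3 h4)) ->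
      mesh_cell (M t) i j -> (1 <= mu <= Q)%nat ->
      Rabs (corr1 (M t) Q w (B1h t) (B2h t) i j) <= C * mesh_h (M t) ^ S k' /\
      Rabs (corr2 (M t) Q w (B1h t) (B2h t) i j) <= C * mesh_h (M t) ^ S k').
    { intros t i j mu Hh Hc Hmu.
      assert (Hmin : forall a b c, a <= Rmin b c -> a <= b /\ a <= c).
      { intros a b c Habc; split; eapply Rle_trans;
          [exact Habc | apply Rmin_l | exact Habc | apply Rmin_r]. }
      destruct (Hmin _ _ _ Hh) as [Hh0 Hh'].
      destruct (Hmin _ _ _ Hh') as [Hh12 Hh34].
      destruct (Hmin _ _ _ Hh12) as [Hh1' Hh2'].
      destruct (Hmin _ _ _ Hh34) as [Hh3' Hh4'].
      assert (Hpos : 0 <= mesh_h (M t) ^ S k').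
      { apply pow_le, Rlt_le; eapply Rlt_le_trans; [apply mesh_dx_pos | apply Rmax_l]. }
      assert (HKD1 : forall p q x y, (p + q <= S k')%nat -> Omega (x, y) ->
        Rabs (D1 p q x y) <= K).
      { intros p q x y Hpq Hz; eapply Rle_trans; [apply HK1; assumption | apply Rmax_l]. }
      assert (HKD2 : forall p q x y, (p + q <= S k')%nat -> Omega (x, y) ->
        Rabs (D2 p q x y) <= K).
      { intros p q x y Hpq Hz; eapply Rle_trans; [apply HK2; assumption | apply Rmax_r]. }
      assert (Hadd : forall u v z c, Rabs (u - v) <= c * mesh_h (M t) ^ S k' ->
        c <= Rmax C1 C2 ->
        Rabs (v - z) <= (1 + INR (S k')) * K * mesh_h (M t) ^ S k' ->
        Rabs (u - z) <= E1 * mesh_h (M t) ^ S k').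
      { intros u v z c Huv Hcm Hvz.
        replace (u - z) with ((u - v) + (v - z)) by ring.
        eapply Rle_trans; [apply Rabs_triang|].
        unfold E1; rewrite Rmult_plus_distr_r.
        apply Rplus_le_compat; [|exact Hvz].
        eapply Rle_trans; [exact Huv|]; apply Rmult_le_compat_r; assumption. }
      assert (HV1 : forall s nu, (1 <= nu <= Q)%nat ->
        Rabs (B1h t s i j nu - tpoly (S k')
          (fun p q => D1 p q (xcentre (M t) i) (ycentre (M t) j))
          (xhalf (M t) s i - xcentre (M t) i) (yq t j nu - ycentre (M t) j))
        <= E1 * mesh_h (M t) ^ S k').
      { intros s nu Hnu.
        eapply Hadd; [apply HC1; assumption | apply Rmax_l |].
        apply (taylor_closed_cell (S k') Omega B1 D1 K HD10 HD1c HD1d HKD1);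
          [apply Hcell, Hc | apply edge_closed_cell1; eapply Hyq; eassumption]. }
      assert (HV2 : forall s nu, (1 <= nu <= Q)%nat ->
        Rabs (B2h t s i j nu - tpoly (S k')
          (fun p q => D2 p q (xcentre (M t) i) (ycentre (M t) j))
          (xq t i nu - xcentre (M t) i) (yhalf (M t) s j - ycentre (M t) j))
        <= E1 * mesh_h (M t) ^ S k').
      { intros s nu Hnu.
        eapply Hadd; [apply HC2; assumption | apply Rmax_r |].
        apply (taylor_closed_cell (S k') Omega B2 D2 K HD20 HD2c HD2d HKD2);
          [apply Hcell, Hc | apply edge_closed_cell2; eapply Hxq; eassumption]. }
      replace (C * mesh_h (M t) ^ S k') with
        (4 * psum Q (fun l => Rabs (w (S l))) * (E1 * mesh_h (M t) ^ S k') +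
         4 * INR (S k') ^ 2 * K * (E2 * mesh_h (M t) ^ S k')) by (unfold C; ring).
      apply corrections_cell_bound with
        (d1 := fun p q => D1 p q (xcentre (M t) i) (ycentre (M t) j))
        (d2 := fun p q => D2 p q (xcentre (M t) i) (ycentre (M t) j))
        (xm := xq t i) (ym := yq t j).
      - exact Hh0.
      - intros p q Hpq; apply Hdiv0; [lia | apply Hcentre, Hc].
      - intros p q Hpq; apply HKD1; [lia | apply Hcentre, Hc].
      - intros p q Hpq; apply HKD2; [lia | apply Hcentre, Hc].
      - exact HV1.
      - exact HV2.
      - intros n Hn; eapply Rle_trans.
        + apply (HC3 n t i j mu); try assumption; lia.
        + apply Rmult_le_compat_r; [exact Hpos | apply Rmax_l].
      - intros n Hn; eapply Rle_trans.
        + apply (HC4 n t i j mu); try assumption; lia.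
        + apply Rmult_le_compat_r; [exact Hpos | apply Rmax_r].
      - eapply Rle_trans; [apply Rabs_pos | apply (HV1 upper mu Hmu)]. }
    assert (Hh0 : 0 < Rmin 2 (Rmin (Rmin h1 h2) (Rmin h3 h4))).
    { repeat apply Rmin_pos; lra. }
    split; exists C, (Rmin 2 (Rmin (Rmin h1 h2) (Rmin h3 h4)));
      (split; [exact Hh0|]); intros t i j mu Hh Hc Hmu;
      apply (Hall t i j mu Hh Hc Hmu). }
  destruct Hcorr as [Hcorr1 Hcorr2].
  split; intros s.
  - apply (bigO_h_lincomb M Q k _ _ _ (fun _ _ _ => sgn s) 1 (HB1h s) Hcorr1).
    + intros; destruct s; simpl; split_Rabs; lra.
    + intros; unfold modified1; ring.
  - apply (bigO_h_lincomb M Q k _ _ _ (fun _ _ _ => sgn s) 1 (HB2h s) Hcorr2).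
    + intros; destruct s; simpl; split_Rabs; lra.
    + intros; unfold modified2; ring.
Qed.
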